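(* Let $n,m\ge 1$, let $d_1,\dots,d_n$ be positive integers, and let $(A_1,B_1),\dots,(A_m,B_m)$ be partitions of $[n]$ (that is, $A_i\cup B_i=[n]$ and $A_i\cap B_i=\emptyset$ for each $i$). An $m$-tuple of real $d_1\times\cdots\times d_n$ arrays $C^1,\dots,C^m$ are compatible full conditionals for the partitions $(A_1,B_1),\dots,(A_m,B_m)$ if and only if the following four conditions hold: (1) $C^i_{j_1\cdots j_n}\ge 0$ for all $i$ and all $j_1,\dots,j_n$. (2) If $C^{i_0}_{j_1\cdots j_n}=0$ for some $i_0$, then $C^{i}_{j_1\cdots j_n}=0$ for all $i$. (3) For each $i$, the $B_i$-margin of $C^i$ is an array of all ones. (4) For every induced circuit $c$ of the bipartite graph $G$ determined by $d_1,\dots,d_n$ and $(A_1,B_1),\dots,(A_m,B_m)$, the entries of $C^1,\dots,C^m$ satisfy $f_c=0$, where $f_c$ is the circuit binomial of $c$.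
   Context: Notation: $[k]=\{1,\dots,k\}$. For $j=(j_1,\dots,j_n)\in[d_1]\times\cdots\times[d_n]$ and $B=\{k_1<\cdots<k_s\}\subseteq[n]$ write $j_B=(j_{k_1},\dots,j_{k_s})$. The $B$-margin of an array $C$ is the array indexed by $b\in\prod_{k\in B}[d_k]$ with entries $\sum_{j:\,j_B=b}C_j$. Compatibility: $X_1,\dots,X_n$ are discrete random variables, $X_k$ taking values in $[d_k]$; a joint distribution is a nonnegative $d_1\times\cdots\times d_n$ array $p$ with entries summing to $1$. The arrays $C^1,\dots,C^m$ are compatible full conditionals for $(A_1,B_1),\dots,(A_m,B_m)$ if there is a joint distribution $p$ such that $C^i=p(x_{A_i}\mid x_{B_i})$ for all $i$, i.e. for every $i$ every entry of the $B_i$-margin $p_{B_i}$ of $p$ is positive (so that the conditional array is defined) and $C^i_j=p_j/p_{B_i}(j_{B_i})$ for all $j$. The graph $G$: it has one vertex $(0,j)$ for each $j\in[d_1]\times\cdots\times[d_n]$, and one vertex $(i,b)$ for each $i\in[m]$ and each $b\in\prod_{k\in B_i}[d_k]$. The vertex $(0,j)$ is adjacent to $(i,b)$ (with $i\ge1$) if and only if $b=j_{B_i}$; there are no other edges. Thus the edges correspond bijectively to pairs $(i,j)$, and the edge joining $(0,j)$ to $(i,j_{B_i})$ is labeled by the entry $C^i_j$. An induced circuit of a graph is a circuit (simple closed cycle) that has no chord in the graph. For a circuit $c$ of $G$ with successive edges $e_1,e_2,\dots,e_{2r}$ (in cyclic order) the circuit binomial is $$f_c=\prod_{t=1}^{r}C(e_{2t-1})-\prod_{t=1}^{r}C(e_{2t}),$$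 where $C(e)$ denotes the array entry labeling the edge $e$ (well defined up to sign). *)

(* Defs.v *)
From HB Require Import structures.
From mathcomp Require Import all_boot all_order all_algebra.
From mathcomp Require Import reals.

Set Implicit Arguments.
Unset Strict Implicit.
Unset Printing Implicit Defensive.

Import Order.TTheory GRing.Theory Num.Theory.
Local Open Scope ring_scope.

(* All index sets are 0-based: [n] is 'I_n and [d_k] is 'I_(d k). *)

Definition index_of (n : nat) (d : 'I_n -> nat) : predArgType :=
  {dffun forall k : 'I_n, 'I_(d k)}.
HB.instance Definition _ n (d : 'I_n -> nat) := Finite.on (index_of d).

Definition subindex (n : nat) (d : 'I_n -> nat) (B : {set 'I_n}) :
    predArgType :=
  {dffun forall k : {k : 'I_n | k \in B}, 'I_(d (val k))}.
HB.instance Definition _ n (d : 'I_n -> nat) (B : {set 'I_n}) :=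
  Finite.on (subindex d B).

Definition restr (n : nat) (d : 'I_n -> nat) (B : {set 'I_n})
    (j : index_of d) : subindex d B :=
  [ffun k : {k : 'I_n | k \in B} => j (val k)].

Definition margin (R : realType) (n : nat) (d : 'I_n -> nat)
    (B : {set 'I_n}) (c : index_of d -> R) (b : subindex d B) : R :=
  \sum_(j : index_of d | restr B j == b) c j.

Definition joint_distribution (R : realType) (n : nat) (d : 'I_n -> nat)
    (p : index_of d -> R) : Prop :=
  (forall j, 0 <= p j) /\ \sum_(j : index_of d) p j = 1.

(* [c] is p(x_A | x_B) for A the complement of B: then p_{A u B} = p, so A does
   not appear. Positivity of the B-margin makes the conditional defined. *)
Definition is_full_conditional (R : realType) (n : nat) (d : 'I_n -> nat)
    (B : {set 'I_n}) (p c : index_of d -> R) : Prop :=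
  (forall b : subindex d B, 0 < margin p b) /\
  (forall j : index_of d, c j = p j / margin p (restr B j)).

Definition compatible (R : realType) (n m : nat) (d : 'I_n -> nat)
    (B : 'I_m -> {set 'I_n}) (C : 'I_m -> index_of d -> R) : Prop :=
  exists p : index_of d -> R,
    joint_distribution p /\ forall i : 'I_m, is_full_conditional (B i) p (C i).

(* [inl j] is the vertex (0, j), and [inr (Tagged _ b)] with tag i is the
   vertex (i, b). *)
Definition vertex (n m : nat) (d : 'I_n -> nat) (B : 'I_m -> {set 'I_n}) :
    predArgType :=
  (index_of d + {i : 'I_m & subindex d (B i)})%type.
HB.instance Definition _ n m (d : 'I_n -> nat) (B : 'I_m -> {set 'I_n}) :=
  Finite.on (vertex d B).

Definition adj (n m : nat) (d : 'I_n -> nat) (B : 'I_m -> {set 'I_n}) :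
    rel (vertex d B) := fun x y =>
  match x, y with
  | inl j, inr v | inr v, inl j => tagged v == restr (B (tag v)) j
  | _, _ => false
  end.

(* A circuit is given by its successive vertices, from an arbitrary starting
   point and in an arbitrary direction. *)
Definition circuit (T : eqType) (e : rel T) (s : seq T) : Prop :=
  [/\ cycle e s, uniq s & (2 < size s)%N].

Definition induced_circuit (T : eqType) (e : rel T) (s : seq T) : Prop :=
  circuit e s /\
  {in s &, forall x y, e x y -> y = next s x \/ x = next s y}.

(* Only meaningful on adjacent vertices; any other value is junk. *)
Definition edge_label (R : realType) (n m : nat) (d : 'I_n -> nat)
    (B : 'I_m -> {set 'I_n}) (C : 'I_m -> index_of d -> R)
    (x y : vertex d B) : R :=
  match x, y with
  | inl j, inr v | inr v, inl j => C (tag v) j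
  | _, _ => 0
  end.

(* The successive edges are {x, next s x} for x in s, so the edges e_1, e_3, ...
   are those starting at the vertices of even 0-based position. *)
Definition circuit_binomial (R : realType) (n m : nat) (d : 'I_n -> nat)
    (B : 'I_m -> {set 'I_n}) (C : 'I_m -> index_of d -> R)
    (s : seq (vertex d B)) : R :=
  \prod_(x <- s | ~~ odd (index x s)) edge_label C x (next s x)
  - \prod_(x <- s | odd (index x s)) edge_label C x (next s x).

(* Main.v *)
(** On the support of the arrays, label the step from [(i,b)] to [(0,j)] by [C^i_j]
    and the reverse step by its inverse.  A chord splits a circuit into two shorter
    closed walks whose weights multiply to that of the circuit, so if induced
    circuits have weight 1, so does every closed walk, and the weights are the
    quotients of a positive potential.  The potential on the vertices [(0,j)] is
    the joint distribution up to normalization; by (3) its value at [(i,b)] is the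
    margin. *)
Require Import Defs.
From mathcomp Require Import all_boot all_order all_algebra.
From mathcomp Require Import reals zify.
Import Order.TTheory GRing.Theory Num.Theory.
Local Open Scope ring_scope.

(** * Products around a circuit of a two-coloured graph *)

Section Next.
Variables (T : eqType).
Implicit Types (s : seq T).

Lemma map_next_perm s : uniq s -> perm_eq (map (next s) s) s.
Proof.
move=> us; have ninj : injective (next s) by apply: can_inj (prev_next us).
apply: uniq_perm => //; first by rewrite map_inj_uniq.
have un : uniq (map (next s) s) by rewrite map_inj_uniq.
have sub : {subset map (next s) s <= s}.
  by move=> _ /mapP[x xs ->]; rewrite mem_next.
by have [_ eqs] := uniq_min_size un sub (eq_leq (esym (size_map _ _))).
Qed.

Variables (e : rel T) (col : pred T).
Hypothesis bip : forall x y, e x y -> col y = ~~ col x.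

Lemma col_index_path x p y : path e x p -> y \in x :: p ->
  col y = col x (+) odd (index y (x :: p)).
Proof.
elim: p x => [|z p IH] x /=.
  by move=> _; rewrite inE => /eqP ->; rewrite eqxx addbF.
case/andP=> exz pzp; rewrite inE (eq_sym x y); case: eqVneq => [->|_ /= yzp].
  by rewrite addbF.
by rewrite (IH z pzp yzp) (bip _ _ exz) /= addNb addbN.
Qed.

(** [next s] permutes the circuit and flips the colour, so it reindexes one colour class by the
    other. *)
Lemma prod_next_bip (R : comNzRingType) s b (f : T -> R) : uniq s -> cycle e s ->
  \prod_(x <- s | col x == b) f (next s x) = \prod_(x <- s | col x == ~~ b) f x.
Proof.
move=> us cs; rewrite -[RHS](perm_big _ (map_next_perm s us)) /= big_map.
rewrite big_seq_cond [RHS]big_seq_cond; apply: eq_bigl => x.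
case xs: (x \in s) => //=; rewrite (bip _ _ (next_cycle cs xs)).
by case: (col x); case: b.
Qed.

(** Colours alternate along the circuit, so position parity and colour agree up to exchanging the
    two sides, according to the colour of the first vertex. Unlike position, colour does not depend
    on the starting point. *)
Lemma prod_parity_eq (R : comNzRingType) s (f : T -> R) : cycle e s ->
  \prod_(x <- s | ~~ odd (index x s)) f x = \prod_(x <- s | odd (index x s)) f x
  <-> \prod_(x <- s | col x == true) f x = \prod_(x <- s | col x == false) f x.
Proof.
case: s => [|x q] cs; first by rewrite !big_nil.
set s := x :: q; have colE y : y \in s -> col y = col x (+) odd (index y s).
  apply: col_index_path; move: cs; rewrite /= rcons_path.
  by case/andP.
have E b : \prod_(y <- s | odd (index y s) == b) f y
    = \prod_(y <- s | col y == col x (+) b) f y.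
  rewrite big_seq_cond [RHS]big_seq_cond; apply: eq_bigl => y.
  case ys: (y \in s) => //=; rewrite (colE _ ys).
  by case: (col x); case: b; case: (odd _).
have -> : \prod_(y <- s | ~~ odd (index y s)) f y
    = \prod_(y <- s | col y == col x (+) false) f y.
  by rewrite -E; apply: eq_bigl => y; case: (odd _).
have -> : \prod_(y <- s | odd (index y s)) f y
    = \prod_(y <- s | col y == col x (+) true) f y.
  by rewrite -E; apply: eq_bigl => y; case: (odd _).
by case: (col x) => /=; split.
Qed.

End Next.

(** * Weights of closed walks, and potentials *)

Section ClosedWalks.
Variables (R : realFieldType) (T : finType) (e : rel T) (w : T -> T -> R).
Implicit Types (x y : T) (p q s : seq T).

Definition walk_weight x p : R := \prod_(a <- pairmap w x p) a.

Lemma walk_weight_nil x : walk_weight x [::] = 1.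
Proof. by rewrite /walk_weight big_nil. Qed.

Lemma walk_weight_cons x y p :
  walk_weight x (y :: p) = w x y * walk_weight y p.
Proof. by rewrite /walk_weight /= big_cons. Qed.

Lemma walk_weight_cat x p q :
  walk_weight x (p ++ q) = walk_weight x p * walk_weight (last x p) q.
Proof. by rewrite /walk_weight pairmap_cat big_cat. Qed.

(** The cyclic product on the right is invariant under rotation, which lets a circuit be restarted
    at an endpoint of a chord. *)
Lemma walk_weight_next x q : uniq (x :: q) ->
  walk_weight x (rcons q x) = \prod_(z <- x :: q) w z (next (x :: q) z).
Proof.
move=> us; rewrite /walk_weight -(big_map (fun z => w z (next (x :: q) z)) xpredT id).
congr (\big[_/_]_(_ <- _) _); apply: (@eq_from_nth _ 0).
  by rewrite size_map size_pairmap size_rcons.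
move=> i; rewrite size_pairmap size_rcons => li.
rewrite (nth_pairmap x) ?size_rcons // (nth_map x) //.
rewrite -rcons_cons nth_rcons li next_nth mem_nth // index_uniq //.
(* Past the end of [q] the default value [x] of [nth] is exactly the vertex that closes the walk. *)
rewrite nth_rcons; case: ltnP => // qi; rewrite (nth_default _ qi).
by rewrite if_same.
Qed.

Hypotheses (e_sym : symmetric e) (eirr : irreflexive e).
Hypothesis w_gt0 : forall x y, e x y -> 0 < w x y.
Hypothesis wV : forall x y, e x y -> w x y * w y x = 1.
Hypothesis w_induced : forall s, induced_circuit e s ->
  \prod_(x <- s) w x (next s x) = 1.

Lemma walk_weight_gt0 x p : path e x p -> 0 < walk_weight x p.
Proof.
elim: p x => [|y p IH] x /=; first by rewrite walk_weight_nil.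
by case/andP=> exy pyp; rewrite walk_weight_cons mulr_gt0 ?w_gt0 ?IH.
Qed.

(** An empty arc would make [v] the successor or the predecessor of [u]. Nonempty arcs make both
    circuits cut off by the chord strictly shorter. *)
Lemma chord_split u t v : uniq (u :: t) -> v \in u :: t -> e u v ->
  v != next (u :: t) u -> u != next (u :: t) v ->
  exists a b, [/\ t = a ++ v :: b, (0 < size a)%N & (0 < size b)%N].
Proof.
move=> us vs euv nv nu; have vu : v != u.
  by apply: contraTneq euv => ->; rewrite eirr.
have vt : v \in t by move: vs; rewrite inE (negPf vu).
case/splitPr: vt us nv nu => a b us nv nu.
exists a, b; split=> //.
- by case: a us nv nu => // us; rewrite /= !eqxx.
(* If [b] is empty, [v] comes last and its [next] wraps around to [u], the default value of
   [nth]. *)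
- case: b us nv nu => // us nv; rewrite next_nth inE mem_cat mem_head orbT orbT.
  have -> : index v (u :: a ++ [:: v]) = (size a).+1.
    rewrite -[_ :: _]/((u :: a) ++ [:: v]) index_cat ifN /= ?eqxx ?addn0 //.
    move: us; rewrite -[_ :: _]/((u :: a) ++ [:: v]) cat_uniq /=.
    by rewrite orbF => /and3P[].
  by rewrite nth_default ?size_cat /= ?addn1 ?eqxx.
Qed.

(** Strong induction on length: a closed walk of more than two steps that is not an induced circuit
    decomposes into shorter closed walks. *)
Lemma closed_walk_weight x p : path e x p -> last x p = x -> walk_weight x p = 1.
Proof.
have [k] := ubnP (size p); elim: k x p => // k IH x p.
case/lastP: p => [|q z]; first by rewrite walk_weight_nil.
rewrite size_rcons ltnS last_rcons => lk pq zx; rewrite {z}zx in pq *.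
have [us|] := boolP (uniq (x :: q)); last first.
  rewrite cons_uniq negb_and negbK => /orP[xq|nuq].
    (* A return to [x] before the end cuts the walk into two shorter closed walks. *)
    case/splitPr: xq lk pq => q1 q2; rewrite size_cat /= => lk.
    rewrite -cat_rcons rcons_cat cat_path last_rcons => /andP[p1 p2].
    by rewrite walk_weight_cat last_rcons !IH ?mul1r ?last_rcons // size_rcons; lia.
  (* A repeated inner vertex [y] bounds a closed subwalk, which has weight 1 by induction and is cut
     out. *)
  have [y [q1 [q2 [q3 qE]]]] : exists y q1 q2 q3, q = q1 ++ y :: q2 ++ y :: q3.
    elim: q nuq {lk pq} => // y q IHq /=; rewrite negb_and negbK.
    case/orP=> [yq|/IHq[z [q1 [q2 [q3 ->]]]]]; last by exists z, (y :: q1), q2, q3.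
    by case/splitPr: yq => q2 q3; exists y, [::], q2, q3.
  have rqE : rcons q x = rcons q1 y ++ rcons q2 y ++ rcons q3 x.
    by rewrite qE !cat_rcons rcons_cat /= rcons_cat.
  move: pq; rewrite rqE !cat_path !last_rcons => /and3P[p1 p2 p3].
  have sz : (size (rcons q1 y) + (size (rcons q2 y) + size (rcons q3 x)) <= k)%N.
    by rewrite -!size_cat -rqE size_rcons.
  rewrite !walk_weight_cat !last_rcons [walk_weight y (rcons q2 y)]IH ?last_rcons //; last first.
    by rewrite !size_rcons in sz *; lia.
  rewrite mul1r -{2}(last_rcons x q1 y) -walk_weight_cat IH //.
  - by rewrite size_cat !size_rcons in sz *; lia.
  - by rewrite cat_path p1 last_rcons.
  - by rewrite last_cat last_rcons.
have cs : cycle e (x :: q) by [].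
case: (ltnP 2 (size (x :: q))) => [sz|]; last first.
  (* One step would be a loop; two steps run along an edge and back, with weight 1 by [wV]. *)
  case: q us lk pq {cs} => [|y [|//]] _ _ /=; first by rewrite eirr.
  by case/and3P=> exy _ _; rewrite !walk_weight_cons walk_weight_nil mulr1 wV // => _.
set s := x :: q in us cs sz.
have [/allP ind|] := boolP (all (fun u => all (fun v =>
   e u v ==> (v == next s u) || (u == next s v)) s) s).
  rewrite walk_weight_next // w_induced //; split=> // u v us' vs euv.
  by have /allP/(_ _ vs) := ind _ us'; rewrite euv => /orP[] /eqP; [left|right].
case/allPn=> u us' /allPn[v vs]; rewrite negb_imply negb_or => /and3P[euv nv nu].
(* The circuit is restarted at the endpoint [u] of the chord. *)
have [i t rE] := rot_to us'.
have ust : uniq (u :: t) by rewrite -rE rot_uniq.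
have cst : cycle e (u :: t) by rewrite -rE rot_cycle.
have szt : size t = size q by have := size_rot i s; rewrite rE => -[].
have vst : v \in u :: t by rewrite -rE mem_rot.
have nE z : next s z = next (u :: t) z by rewrite -rE next_rot.
have -> : walk_weight x (rcons q x) = walk_weight u (rcons t u).
  rewrite (walk_weight_next _ _ us) (walk_weight_next _ _ ust).
  rewrite [RHS](perm_big s) => [|/=]; first by apply: eq_bigr => z _; rewrite nE.
  by rewrite -rE perm_rot.
rewrite !nE in nv nu; have [a [b [tE a0 b0]]] := chord_split u t v ust vst euv nv nu.
rewrite -szt tE size_cat /= addnS in lk.
move: cst; rewrite tE /= rcons_cat /= -cat_rcons cat_path last_rcons.
case/andP=> pa pb.
(* The chord closes each arc: along [a] to [v] and back by the chord, then by the chord to [v] and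
   back along [b]. *)
have wa : walk_weight u (rcons (rcons a v) u) = 1.
  apply: IH; last by rewrite last_rcons.
    rewrite !size_rcons; apply: leq_trans _ lk.
    by rewrite !ltnS -[X in (X < _)%N]addn0 ltn_add2l.
  by rewrite rcons_path pa last_rcons e_sym.
have wb : walk_weight u (v :: rcons b u) = 1.
  apply: IH; last by rewrite /= last_rcons.
    rewrite /= !size_rcons; apply: leq_trans _ lk.
    by rewrite !ltnS -[X in (X < _)%N]add0n ltn_add2r.
  by rewrite /= euv.
rewrite walk_weight_cat last_rcons.
move: wa wb; rewrite -[rcons (rcons a v) u]cats1 walk_weight_cat last_rcons.
rewrite !walk_weight_cons walk_weight_nil mulr1 => wa wb.
(* The two opposite passes over the chord cancel by [wV]. *)
by rewrite -[RHS]mulr1 -{1}wa -wb -mulrA (mulrA (w v u)) wV ?mul1r // e_sym.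
Qed.

(** Both walks are closed by the same return walk [r], whose positive weight is then cancelled. *)
Lemma walk_weight_eq x p q : path e x p -> path e x q -> last x p = last x q ->
  walk_weight x p = walk_weight x q.
Proof.
move=> pp pq pqE.
have /connectP[r pr xE] : connect e (last x p) x.
  by rewrite (sym_connect_sym e_sym); apply/connectP; exists p.
have r0 := walk_weight_gt0 _ _ pr.
apply: (mulIf (lt0r_neq0 r0)); rewrite {2}pqE -!walk_weight_cat.
by rewrite !closed_walk_weight ?cat_path ?pp ?pq ?last_cat -?pqE.
Qed.

(** The potential of a vertex is the weight of a chosen walk from the root of its component; path
    independence makes it compatible with every edge. *)
Lemma potential_exists : exists phi : T -> R,
  (forall x, 0 < phi x) /\ (forall x y, e x y -> phi y = phi x * w x y).
Proof.
have csym := sym_connect_sym e_sym.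
have walk x : {p | path e (fingraph.root e x) p && (x == last (fingraph.root e x) p)}.
  apply: sigW; have /connectP[p pp xE] : connect e (fingraph.root e x) x.
    by rewrite csym connect_root.
  by exists p; rewrite pp -xE eqxx.
exists (fun x => walk_weight (fingraph.root e x) (sval (walk x))); split=> [x|x y exy].
  by case: (walk x) => p /= /andP[pp _]; apply: walk_weight_gt0.
case: (walk x) (walk y) => p /= /andP[pp /eqP xE] [q /= /andP[pq /eqP yE]].
have rE : fingraph.root e y = fingraph.root e x.
  by apply/eqP; rewrite root_connect // csym connect1.
rewrite rE in pq yE *; rewrite {3}xE -[w _ y]mulr1 -(walk_weight_nil y).
rewrite -walk_weight_cons -walk_weight_cat; apply: walk_weight_eq => //.
  by rewrite cat_path pp /= -xE exy.
by rewrite last_cat.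
Qed.

End ClosedWalks.

(** * Conditional arrays on the graph [G] *)

Section Conditionals.
Variables (R : realType) (n m : nat) (d : 'I_n -> nat) (B : 'I_m -> {set 'I_n}).
Variable (C : 'I_m -> index_of d -> R).
Implicit Types (x y : vertex d B) (s : seq (vertex d B)).

Definition margin_vertex i (b : subindex d (B i)) : vertex d B :=
  inr (Tagged (fun i => subindex d (B i)) b).

Definition is_index x : bool := if x is inl _ then true else false.

Lemma adj_bip x y : adj x y -> is_index y = ~~ is_index x.
Proof. by case: x; case: y. Qed.

Lemma adj_sym : symmetric (@adj n m d B).
Proof. by case=> [?|?] [?|?]. Qed.

Lemma circuit_binomial_eq0 s : cycle (@adj n m d B) s ->
  circuit_binomial C s = 0 <->
  \prod_(x <- s | is_index x == true) edge_label C x (next s x)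
  = \prod_(x <- s | is_index x == false) edge_label C x (next s x).
Proof.
move=> cs; rewrite -(prod_parity_eq _ _ _ adj_bip) // /circuit_binomial.
by split=> [/subr0_eq|->]; rewrite ?subrr.
Qed.

(** Each label is a product of two factors, one per endpoint: [p j] and the inverse of a margin.
    Both products of the binomial therefore run over all vertices of the circuit; chords do not
    matter. *)
Lemma compatible_circuit_binomial p s :
  (forall i, is_full_conditional (B i) p (C i)) ->
  cycle (@adj n m d B) s -> uniq s -> circuit_binomial C s = 0.
Proof.
move=> pC cs us; apply/circuit_binomial_eq0 => //.
pose num x := if x is inl j then p j else 1.
pose den x := if x is inr v then (margin p (tagged v))^-1 else 1.
have lab x : x \in s -> edge_label C x (next s x)
    = (num x * den x) * (num (next s x) * den (next s x)).
  move=> xs; have := next_cycle cs xs; case: x {xs} => [j|v]; case: (next s _) => //=.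
    by move=> v /eqP vE; rewrite (pC (tag v)).2 -vE mulr1 mul1r.
  by move=> j /eqP vE; rewrite (pC (tag v)).2 -vE mulr1 mul1r mulrC.
have E b : \prod_(x <- s | is_index x == b) edge_label C x (next s x)
  = \prod_(x <- s | is_index x == b) (num x * den x)
    * \prod_(x <- s | is_index x == ~~ b) (num x * den x).
  rewrite -(prod_next_bip _ _ _ adj_bip _ _ _ _ us cs) -big_split.
  rewrite big_seq_cond [RHS]big_seq_cond.
  by apply: eq_bigr => x /andP[xs _]; rewrite lab.
by rewrite !E mulrC.
Qed.

Hypothesis C_ge0 : forall i j, 0 <= C i j.
Hypothesis C_eq0 : forall i0 j, C i0 j = 0 -> forall i, C i j = 0.
Hypothesis C_margin : forall i (b : subindex d (B i)), margin (C i) b = 1.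
Hypothesis C_circuit : forall s,
  induced_circuit (@adj n m d B) s -> circuit_binomial C s = 0.
Variable i0 : 'I_m.

(** By [C_eq0], every choice of [i0] gives the same set. In [support_adj] the vertices outside it
    become isolated. *)
Definition in_support x : bool := if x is inl j then C i0 j != 0 else true.

Definition support_adj : rel (vertex d B) :=
  fun x y => [&& adj x y, in_support x & in_support y].

Definition step_weight x y : R :=
  if is_index x then (edge_label C x y)^-1 else edge_label C x y.

Lemma support_gt0 i j : C i0 j != 0 -> 0 < C i j.
Proof.
move=> C0; rewrite lt0r C_ge0 andbT; apply: contraNneq C0 => Cij.
by apply/eqP; apply: C_eq0 Cij _.
Qed.

Lemma edge_label_gt0 x y : support_adj x y -> 0 < edge_label C x y.
Proof.
by case: x y => [j|v] [j'|v'] //= /and3P[_ S1 S2]; apply: support_gt0.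
Qed.

Lemma step_weight_induced s : induced_circuit support_adj s ->
  \prod_(x <- s) step_weight x (next s x) = 1.
Proof.
case=> -[cs us sz] ind.
have sS x : x \in s -> in_support x by move=> /(next_cycle cs)/and3P[].
have cs' : cycle (@adj n m d B) s by apply: sub_cycle cs => x y /and3P[].
(* The support graph is an induced subgraph of [G], so a chord in [G] would already be a chord in
   it. *)
have /circuit_binomial_eq0 : circuit_binomial C s = 0.
  apply: C_circuit; split=> // x y xs ys xy; apply: ind => //.
  by rewrite /support_adj xy !sS.
move=> /(_ cs') E; rewrite (bigID is_index) /=.
have lab b : \prod_(x <- s | is_index x == b) edge_label C x (next s x) != 0.
  rewrite big_seq_cond prodf_seq_neq0; apply/allP => x xs; apply/implyP=> _.
  by rewrite gt_eqF // edge_label_gt0 // (next_cycle cs).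
have -> : \prod_(x <- s | is_index x) step_weight x (next s x)
    = (\prod_(x <- s | is_index x == true) edge_label C x (next s x))^-1.
  rewrite -prodfV; apply: eq_big => [x|x xi]; first by rewrite eqb_id.
  by rewrite /step_weight xi.
have -> : \prod_(x <- s | ~~ is_index x) step_weight x (next s x)
    = \prod_(x <- s | is_index x == false) edge_label C x (next s x).
  apply: eq_big => [x|x /negPf xi]; first by rewrite eqbF_neg.
  by rewrite /step_weight xi.
by rewrite E mulVf.
Qed.

Lemma circuits_compatible (j0 : index_of d) : compatible B C.
Proof.
have adjS : symmetric support_adj.
  by move=> x y; rewrite /support_adj adj_sym [in_support x && _]andbC.
have [phi [phi_gt0 phiE]] : exists phi : vertex d B -> R,
    (forall x, 0 < phi x) /\
    (forall x y, support_adj x y -> phi y = phi x * step_weight x y).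
  apply: potential_exists => //; last exact: step_weight_induced.
  - by case.
  - move=> x y xy; rewrite /step_weight; case: ifP => _; rewrite ?invr_gt0;
    exact: edge_label_gt0.
  - move=> x y xy; have := edge_label_gt0 _ _ xy.
    case: x y xy => [j|v] [j'|v'] //= _ L0; rewrite /step_weight /= ?mulVf ?mulfV //;
    exact: lt0r_neq0.
(* The unnormalized joint distribution: the potential, extended by zero off the support. *)
pose q (j : index_of d) := if C i0 j == 0 then 0 else phi (inl j).
have q_ge0 j : 0 <= q j by rewrite /q; case: ifP => // _; exact: ltW.
have qE i j : q j = C i j * phi (margin_vertex i (restr (B i) j)).
  rewrite /q; case: eqVneq => [/C_eq0 ->|S]; first by rewrite mul0r.
  rewrite [LHS](phiE (margin_vertex i (restr (B i) j))); first by rewrite mulrC.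
  by rewrite /support_adj /= S eqxx.
(* Summing [qE] over a fibre, where the potential of the margin vertex is constant, leaves a margin
   of [C i], equal to 1. *)
have q_margin i (b : subindex d (B i)) : margin q b = phi (margin_vertex i b).
  rewrite -[RHS]mul1r -(C_margin i b) /margin mulr_suml.
  by apply: eq_bigr => j /eqP <-; exact: qE.
pose Z := \sum_j q j.
(* The total mass dominates the margin at the restriction of [j0], which is a value of the positive
   potential. *)
have Z_gt0 : 0 < Z.
  apply: lt_le_trans (phi_gt0 (margin_vertex i0 (restr (B i0) j0))) _.
  rewrite -q_margin /Z /margin big_mkcond; apply: ler_sum => j _.
  by case: ifP.
have p_margin i (b : subindex d (B i)) :
    margin (fun j => q j / Z) b = phi (margin_vertex i b) / Z.
  by rewrite -q_margin /margin mulr_suml.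
exists (fun j => q j / Z); split.
  split=> [j|]; first by rewrite divr_ge0 // ltW.
  by rewrite -mulr_suml divff // gt_eqF.
move=> i; split=> [b|j]; first by rewrite p_margin divr_gt0.
rewrite p_margin (qE i) invf_div mulrA mulfVK ?gt_eqF //.
by rewrite mulfK // gt_eqF.
Qed.

End Conditionals.

Theorem theorem2 (R : realType) (n m : nat) (hn : (0 < n)%N) (hm : (0 < m)%N)
    (d : 'I_n -> nat) (hd : forall k, (0 < d k)%N)
    (A B : 'I_m -> {set 'I_n})
    (hAB : forall i, A i :|: B i = [set: 'I_n] /\ A i :&: B i = set0)
    (C : 'I_m -> index_of d -> R) :
  compatible B C <->
  [/\ (forall i j, 0 <= C i j),
      (forall i0 j, C i0 j = 0 -> forall i, C i j = 0),
      (forall i (b : subindex d (B i)), margin (C i) b = 1) &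
      (forall s : seq (vertex d B),
         induced_circuit (@adj n m d B) s -> circuit_binomial C s = 0)].
Proof.
split=> [[p [[p_ge0 _] pC]]|[C_ge0 C_eq0 C_margin C_circuit]].
  split=> [i j|i0 j|i b|s [[cs us _] _]].
  - by rewrite (pC i).2 divr_ge0 // ltW // (pC i).1.
  - rewrite (pC i0).2 => /eqP; rewrite mulf_eq0 invr_eq0 (gt_eqF ((pC i0).1 _)).
    by rewrite orbF => /eqP p0 i; rewrite (pC i).2 p0 mul0r.
  - transitivity (margin p b / margin p b); last by rewrite divff // gt_eqF // (pC i).1.
    rewrite {1 2}/margin mulr_suml; apply: eq_bigr => j /eqP bE.
    by rewrite (pC i).2 bE.
  - exact: compatible_circuit_binomial pC cs us.
(* Positivity of all [d k] and of [m] provides the base points [j0] and [i0]. *)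
have j0 : index_of d := [ffun k => Ordinal (hd k)].
exact: (circuits_compatible _ _ _ _ _ C C_ge0 C_eq0 C_margin C_circuit (Ordinal hm) j0).
Qed.
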